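(* Let $(\Omega,\mu)$ be a measure space, $p\ge3$, and let $(u_k)$, $u$ be real-valued functions in $L^p(\Omega,\mu)$ such that $u_k\rightharpoonup u$ weakly and $u_k\rightharpoondown u$ in $L^p(\Omega,\mu)$. Then $$\liminf_{k\to\infty}\Big(\int_\Omega|u_k|^pd\mu-\int_\Omega|u|^pd\mu-\int_\Omega|u_k-u|^pd\mu\Big)\ge0.$$
   Context: $u_k\rightharpoondown u$ (Δ-convergence) in a Banach space $X$ means: for every $v\in X$, $\limsup_{k\to\infty}(\|u_k-u\|-\|u_k-v\|)\le0$. *)

(* Defs.v *)
From HB Require Import structures.
From mathcomp Require Import all_boot all_order all_algebra.
From mathcomp Require Import all_classical all_reals all_analysis.
Set Implicit Arguments. Unset Strict Implicit. Unset Printing Implicit Defensive.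
Import Order.TTheory GRing.Theory Num.Theory.
Import numFieldNormedType.Exports.
Local Open Scope classical_set_scope.
Local Open Scope ring_scope.

Section Defs.
Context d (T : measurableType d) (R : realType).
Variables (mu : {measure set T -> \bar R}) (p : R).

(* the L^p norm of a real-valued function, as a real number
   (finite for elements of L^p) *)
Definition Lpnorm (f : T -> R) : R := fine ('N[mu]_p%:E[EFin \o f])%E.

Definition Lp_dual (phi : (T -> R) -> R) : Prop :=
  (forall (a : R) (f g : T -> R), f \in Lfun mu p%:E -> g \in Lfun mu p%:E ->
      phi (fun x => a * f x + g x) = a * phi f + phi g) /\
  (exists C : R, forall f : T -> R, f \in Lfun mu p%:E ->
      `|phi f| <= C * Lpnorm f).

Definition Lp_weak_cvg (u : nat -> T -> R) (v : T -> R) : Prop :=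
  forall phi, Lp_dual phi -> (fun k => phi (u k)) @ \oo --> phi v.

Definition Lp_delta_cvg (u : nat -> T -> R) (v : T -> R) : Prop :=
  forall w : T -> R, w \in Lfun mu p%:E ->
    (limn_esup (fun k => ('N[mu]_p%:E[EFin \o (fun x => (u k x - v x)%R)]
                       - 'N[mu]_p%:E[EFin \o (fun x => (u k x - w x)%R)])%E)
       <= 0)%E.

End Defs.

(* Main.v *)
(** With [w_k = u_k - v] and [J s = |s|^(p-2) s], one has, for [p >= 3],
    [|a + b|^p >= |a|^p + |b|^p + p J(a) b + p J(b) a] pointwise, so it is enough
    to control the two cross terms. The integral of [J(v) w_k] tends to 0 by weak
    convergence. For the integral of [J(w_k) v], Delta-convergence tested against
    [v - e v] gives [||w_k + e v|| >= ||w_k|| - e^2] eventually, while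
    [||w_k + e v||^p] is [||w_k||^p] plus [p e] times that integral, up to [O(e^2)];
    hence its liminf is nonnegative. The [O(e^2)] is uniform in [k] because weakly
    convergent sequences are bounded, which is proved by Sokal's gliding hump
    argument carried out on functionals: no completeness of [L^p] is needed. *)
Require Import Defs.
From HB Require Import structures.
From mathcomp Require Import all_boot all_order all_algebra.
From mathcomp Require Import all_classical all_reals all_analysis.
From mathcomp Require Import measurable_realfun.
From mathcomp Require Import ring lra.
Set Implicit Arguments. Unset Strict Implicit. Unset Printing Implicit Defensive.
Import Order.TTheory GRing.Theory Num.Theory.
Import numFieldNormedType.Exports.
Local Open Scope classical_set_scope.
Local Open Scope ring_scope.

(** * Pointwise inequalities for real powers *)

Section PowerInequalities.
Context {R : realType}.
Implicit Types a b x y t p r m : R.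

(** Young's inequality for [x] and [y ^ (p - 1)], with exponents [p] and [p / (p - 1)]; the case
    [p = 1], where the second is infinite, is separate. It is used as the tangent-line bound [x ^ p
    >= y ^ p + p * y ^ (p - 1) * (x - y)]. *)
Lemma young_powR p x y : 1 <= p -> 0 <= x -> 0 <= y ->
  p * (x * y `^ (p - 1)) <= x `^ p + (p - 1) * y `^ p.
Proof.
move=> p1 x0 y0; have [->|pn1] := eqVneq p 1.
  by rewrite subrr powRr0 powRr1// mul0r addr0 mul1r mulr1.
have {pn1}p1' : 1 < p by rewrite lt_neqAle eq_sym pn1.
have p0 : 0 < p by rewrite (lt_trans _ p1').
have q0 : 0 < p / (p - 1) by rewrite divr_gt0// subr_gt0.
have pq : p^-1 + (p / (p - 1))^-1 = 1 by field; lra.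
have := conjugate_powR x0 (powR_ge0 y (p - 1)) p0 q0 pq.
rewrite -powRrM (_ : (p - 1) * (p / (p - 1)) = p); last by field; lra.
rewrite -(ler_pM2l p0) => /le_trans; apply.
by rewrite le_eqVlt; apply/predU1P; left; field; lra.
Qed.

Lemma bernoulli_powR p y : 1 <= p -> 0 <= y -> 1 + p * (y - 1) <= y `^ p.
Proof.
move=> p1 y0; have := young_powR p1 y0 (@ler01 R).
by rewrite !powR1 !mulr1; lra.
Qed.

(** For [r = p - 1] this is the duality map [J], the derivative of [|x| ^ p / p]. The sign factor
    makes it odd and forces the value 0 at 0, even for [r = 0]. *)
Definition spow r x := Num.sg x * `|x| `^ r.

Lemma spow_ge0 r x : 0 <= x -> r != 0 -> spow r x = x `^ r.
Proof.
rewrite le_eqVlt /spow => /predU1P[<- r0|x0 _].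
  by rewrite sgr0 mul0r powR0.
by rewrite gtr0_sg// mul1r gtr0_norm.
Qed.

Lemma spowN r x : spow r (- x) = - spow r x.
Proof. by rewrite /spow sgrN normrN mulNr. Qed.

Lemma spowM r x y : spow r (x * y) = spow r x * spow r y.
Proof. by rewrite /spow sgrM normrM powRM// mulrACA. Qed.

Lemma spow_mulr r x : 0 <= r -> spow r x * x = `|x| `^ (r + 1).
Proof.
move=> r0; rewrite /spow mulrAC -normrEsg -{1}(addrK 1 r) mulr_powRB1//.
by rewrite ltr_wpDl.
Qed.

Lemma ler_norm_spow r x : `|spow r x| <= `|x| `^ r.
Proof.
rewrite /spow normrM (ger0_norm (powR_ge0 _ _)) normr_sg.
by case: (_ != 0); rewrite ?mul1r ?mul0r ?powR_ge0.
Qed.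

Lemma young_spow p x y : 1 <= p ->
  p * `|spow (p - 1) y * x| <= `|x| `^ p + (p - 1) * `|y| `^ p.
Proof.
move=> p1; apply: le_trans (young_powR p1 (normr_ge0 x) (normr_ge0 y)).
rewrite ler_wpM2l ?(le_trans _ p1)// normrM mulrC ler_wpM2l//.
exact: ler_norm_spow.
Qed.

Lemma ler_norm_spowM p x y : 1 <= p ->
  `|spow (p - 1) y * x| <= `|y| `^ p + `|x| `^ p.
Proof.
move=> p1; have := young_spow x y p1.
have := powR_ge0 `|x| p; have := powR_ge0 `|y| p.
by move: (`|x| `^ p) (`|y| `^ p) `|spow _ _ * _| => X Y Z; nra.
Qed.

(** On [[0, m]] this is the tangent-line bound at the larger point. Oddness transfers it to two
    negative arguments; for opposite signs, each argument is compared with 0 and the two bounds add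
    up. *)
Lemma spow_lipschitz r m x y : 1 <= r -> `|x| <= m -> `|y| <= m ->
  `|spow r x - spow r y| <= r * m `^ (r - 1) * `|x - y|.
Proof.
move=> r1 xm ym.
have r0 : r != 0 by rewrite gt_eqF// (lt_le_trans _ r1).
have rge0 : 0 <= r by exact: le_trans r1.
have m0 : 0 <= m by exact: le_trans xm.
have c0 : 0 <= r * m `^ (r - 1) by rewrite mulr_ge0// powR_ge0.
have nonneg a b : 0 <= b -> b <= a -> a <= m ->
    a `^ r - b `^ r <= r * m `^ (r - 1) * (a - b).
  move=> b0 ba am; have a0 := le_trans b0 ba.
  have := young_powR r1 b0 a0.
  have -> : a `^ r = a * a `^ (r - 1) by rewrite mulr_powRB1// lt_neqAle eq_sym r0.
  have am' : a `^ (r - 1) <= m `^ (r - 1) by rewrite ge0_ler_powR ?nnegrE ?subr_ge0.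
  have : r * a `^ (r - 1) * (a - b) <= r * m `^ (r - 1) * (a - b).
    by rewrite ler_wpM2r ?subr_ge0// ler_wpM2l.
  lra.
have nn a : 0 <= a -> a <= m -> a `^ r <= r * m `^ (r - 1) * a.
  by move=> a0 am; have := nonneg a 0 (lexx _) a0 am; rewrite powR0// !subr0.
wlog xy : x y xm ym / y <= x.
  move=> H; have [|/ltW yx] := leP y x; first exact: H.
  by rewrite distrC (distrC x); exact: H.
have xy0 : 0 <= x - y by rewrite subr_ge0.
rewrite (ger0_norm xy0).
have /andP[xl xu] : - m <= x <= m by rewrite -ler_norml.
have /andP[yl yu] : - m <= y <= m by rewrite -ler_norml.
have [y0|y0] := leP 0 y.
  have x0 := le_trans y0 xy.
  rewrite !spow_ge0// ger0_norm; first exact: nonneg.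
  by rewrite subr_ge0 ge0_ler_powR.
have yN : spow r y = - (- y) `^ r.
  by rewrite -spow_ge0 ?oppr_ge0 1?ltW// spowN opprK.
rewrite yN opprK.
have [x0|x0] := leP 0 x.
  rewrite spow_ge0// ger0_norm; last by rewrite addr_ge0// powR_ge0.
  by rewrite mulrBr lerD// -?mulrN nn//; lra.
have xN : spow r x = - (- x) `^ r.
  by rewrite -spow_ge0 ?oppr_ge0 1?ltW// spowN opprK.
rewrite xN [_ + _ `^ r]addrC ger0_norm.
  have := nonneg (- y) (- x); rewrite opprK [- y + x]addrC; apply; lra.
by rewrite subr_ge0 ge0_ler_powR ?nnegrE ?oppr_ge0 ?lerN2 ?(ltW x0) ?(ltW y0).
Qed.

(* Bernoulli at exponent [p - 2 >= 1], multiplied by [(1 + t)^2], suffices for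
   [t >= 0]; plain Bernoulli suffices for [t < 0]. *)
Lemma powR_cross_unit p t : 3 <= p -> `|t| <= 1 ->
  1 + `|t| `^ p + p * t + p * spow (p - 1) t <= `|1 + t| `^ p.
Proof.
move=> p3; rewrite ler_norml => /andP[tm1 t1].
have p1 : 1 <= p by lra.
have p10 : p - 1 != 0 by rewrite gt_eqF//; lra.
have s0 : 0 <= 1 + t by lra.
rewrite (ger0_norm s0).
have [t0|t0] := leP 0 t.
  rewrite ger0_norm// spow_ge0//.
  have -> : (1 + t) `^ p = (1 + t) ^+ 2 * (1 + t) `^ (p - 2).
    rewrite -powR_mulrn; last lra.
    rewrite -powRD ?subrKC//; apply/implyP => _.
    by rewrite gt_eqF//; lra.
  have B : 1 + (p - 2) * t <= (1 + t) `^ (p - 2).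
    have := @bernoulli_powR (p - 2) (1 + t); rewrite addrAC subrr add0r.
    by apply; lra.
  have : (1 + t) ^+ 2 * (1 + (p - 2) * t) <= (1 + t) ^+ 2 * (1 + t) `^ (p - 2).
    by rewrite ler_wpM2l// sqr_ge0.
  apply: le_trans.
  have tr r (n : nat) : n%:R <= r -> (0 < n)%N -> t `^ r <= t ^+ n.
    move=> nr n0.
    have [->|tn0] := eqVneq t 0.
      by rewrite powR0 ?exprn_ge0// gt_eqF// (lt_le_trans _ nr)// ltr0n.
    by rewrite -powR_mulrn// ger_powR// lt_neqAle eq_sym tn0 t0.
  have h3 : t `^ p <= t ^+ 3 by exact: tr.
  have h2 : t `^ (p - 1) <= t ^+ 2 by apply: tr => //; lra.
  have h4 : p * t `^ (p - 1) <= p * t ^+ 2 by rewrite ler_wpM2l//; lra.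
  (* This is exactly [(1 + t) ^ 2 * (1 + (p - 2) * t)] minus [1 + t ^ 3 + p * t + p * t ^ 2]; here
     [p >= 3] is decisive. *)
  have h5 : 0 <= (p - 3) * (t ^+ 2 + t ^+ 3).
    by apply: mulr_ge0; [lra|rewrite addr_ge0 ?exprn_ge0].
  nra.
have := @bernoulli_powR p (1 + t) p1; rewrite addrAC subrr add0r => B.
have {B} : 1 + p * t <= (1 + t) `^ p by apply: B; lra.
apply: le_trans.
have -> : spow (p - 1) t = - (- t) `^ (p - 1).
  by rewrite -spow_ge0 ?oppr_ge0 1?ltW// spowN opprK.
rewrite ltr0_norm//.
(* Since [|t| <= 1 <= p], the terms [|t| ^ p] and [- p * |t| ^ (p - 1)] have a nonpositive sum. *)
rewrite -mulr_powRB1; [|lra..].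
have := powR_ge0 (- t) (p - 1); move: (_ `^ _) => X X0.
have : - t * X <= p * X by rewrite ler_wpM2r//; lra.
lra.
Qed.

(** Both sides are symmetric in [a], [b] and homogeneous of degree [p], so one may assume
    [|b| <= |a|] and divide by [|a| ^ p], leaving the one-variable case [t = b / a]. *)
Lemma powR_cross p a b : 3 <= p ->
  `|a| `^ p + `|b| `^ p + p * (spow (p - 1) a * b) + p * (spow (p - 1) b * a)
    <= `|a + b| `^ p.
Proof.
move=> p3.
wlog ab : a b / `|b| <= `|a|.
  move=> H; have [|/ltW ba] := leP `|b| `|a|; first exact: H.
  rewrite (addrC a b); apply: le_trans (H _ _ ba).
  by rewrite le_eqVlt; apply/predU1P; left; ring.
have p0 : p != 0 by rewrite gt_eqF//; lra.
have [a0|a0] := eqVneq a 0.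
  move: ab; rewrite a0 normr0 normr_le0 => /eqP ->.
  by rewrite addr0 !normr0 !mulr0 powR0// !addr0.
have t1 : `|b / a| <= 1 by rewrite normf_div ler_pdivrMr ?normr_gt0// mul1r.
move: (b / a) t1 (divfK a0 b) => t t1 bE.
have -> : a + b = a * (1 + t) by rewrite -bE; ring.
have {bE} -> : b = a * t by rewrite -bE mulrC.
have E : spow (p - 1) a * a = `|a| `^ p.
  by rewrite spow_mulr ?subrK//; lra.
rewrite spowM !normrM !powRM//.
have := powR_cross_unit p3 t1.
move=> /(ler_wpM2l (powR_ge0 `|a| p)); apply: le_trans.
rewrite le_eqVlt; apply/predU1P; left.
by rewrite -E; ring.
Qed.

Lemma powRD_le_max p a b : 0 <= p -> 0 <= a -> 0 <= b ->
  (a + b) `^ p <= 2 `^ p * (a `^ p + b `^ p).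
Proof.
move=> p0 a0 b0.
wlog ab : a b a0 b0 / b <= a.
  move=> H; have [|/ltW ba] := leP b a; first exact: H.
  by rewrite addrC (addrC (a `^ p)); exact: H.
apply: (@le_trans _ _ ((2 * a) `^ p)).
  by rewrite ge0_ler_powR ?nnegrE//; lra.
by rewrite powRM// ler_wpM2l ?powR_ge0// lerDl powR_ge0.
Qed.

(** Convexity at [y = x + e * b] gives the first-order bound with slope [J(y)]; replacing it by
    [J(x)] costs a term of order [e ^ 2], by the Lipschitz bound on [[- m, m]]. The error is
    integrable when [x] and [b] are replaced by functions in L^p. *)
Lemma powR_expand p e x b : 2 <= p -> 0 <= e <= 1 ->
  `|x + e * b| `^ p <= `|x| `^ p + p * e * (spow (p - 1) x * b)
     + p * (p - 1) * 2 `^ p * e ^+ 2 * (`|x| `^ p + `|b| `^ p).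
Proof.
move=> p2 /andP[e0 e1].
pose m := `|x| + `|b|; move yE : (x + e * b) => y.
have yB : y - x = e * b by rewrite -yE addrC addKr.
have p1 : 1 <= p by lra.
have ym : `|y| <= m.
  rewrite -yE (le_trans (ler_normD _ _))// lerD2l normrM ger0_norm//.
  by rewrite ler_piMl.
have T : `|y| `^ p <= `|x| `^ p + p * (spow (p - 1) y * (y - x)).
  have := young_spow x y p1.
  rewrite mulrBr spow_mulr ?subrK; last lra.
  have h S : p * S <= p * `|S| by rewrite ler_wpM2l ?ler_norm//; lra.
  by have := h (spow (p - 1) y * x); lra.
have L : `|spow (p - 1) y - spow (p - 1) x| <= (p - 1) * m `^ (p - 2) * (e * `|b|).
  have -> : e * `|b| = `|y - x| by rewrite yB normrM ger0_norm.
  have -> : p - 2 = p - 1 - 1 by ring.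
  by apply: spow_lipschitz => //; [lra|rewrite lerDl].
(* As [|b| <= m], the left side is at most [m ^ p]. *)
have M : m `^ (p - 2) * (`|b| ^+ 2) <= 2 `^ p * (`|x| `^ p + `|b| `^ p).
  apply: (@le_trans _ _ (m `^ p)); last by apply: powRD_le_max => //; lra.
  have m0 : 0 <= m by rewrite addr_ge0.
  apply: (@le_trans _ _ (m `^ (p - 2) * m ^+ 2)).
    by rewrite ler_wpM2l ?powR_ge0// lerXn2r ?nnegrE// lerDr.
  have [->|mn0] := eqVneq m 0.
    by rewrite expr0n mulr0 powR_ge0.
  by rewrite -powR_mulrn// -powRD ?subrK// mn0 implybT.
apply: (le_trans T); rewrite -addrA lerD2l.
rewrite yB.
have : p * ((spow (p - 1) y - spow (p - 1) x) * (e * b)) <=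
    p * ((p - 1) * e ^+ 2 * (2 `^ p * (`|x| `^ p + `|b| `^ p))).
  rewrite ler_wpM2l//; first lra.
  apply: (@le_trans _ _ ((p - 1) * e ^+ 2 * (m `^ (p - 2) * `|b| ^+ 2))).
    apply: (le_trans (ler_norm _)); rewrite normrM (normrM e) (ger0_norm e0).
    apply: (le_trans (ler_wpM2r _ L)); first by rewrite mulr_ge0.
    by rewrite le_eqVlt; apply/predU1P; left; ring.
  by rewrite ler_wpM2l// mulr_ge0 ?sqr_ge0//; lra.
lra.
Qed.

End PowerInequalities.

(** * Extended-real upper and lower limits in epsilon form *)

Section LimInfSup.
Context {R : realType}.
Local Open Scope ereal_scope.

Lemma limn_esup_le0_near (s : (\bar R)^nat) (e : R) : (0 < e)%R ->
  limn_esup s <= 0 -> \forall k \near \oo, s k <= e%:E.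
Proof.
move=> e0 s0; have : limn_esup s < e%:E by rewrite (le_lt_trans s0)// lte_fin.
move=> /ereal_inf_lt[_ [V Voo <-]] Ve; apply: filterS Voo => k Vk.
by apply: le_trans (ltW Ve); apply: ereal_sup_ubound; exists k.
Qed.

Lemma limn_einf_ge0 (s : (\bar R)^nat) :
  (forall e : R, (0 < e)%R -> \forall k \near \oo, (- e)%:E <= s k) ->
  0 <= limn_einf s.
Proof.
move=> h; rewrite /limn_einf oppe_ge0; apply/lee_addgt0Pr => e e0.
rewrite add0e; have He := h _ e0.
apply: (@le_trans _ _ (ereal_sup ((\- s) @` [set k | (- e)%:E <= s k]))).
  by apply: ereal_inf_lbound; exists [set k | (- e)%:E <= s k].
by apply: ge_ereal_sup => _ [k /= sk <-]; rewrite leeNl -EFinN.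
Qed.

End LimInfSup.

(** * The duality pairing on L^p *)

Section Lp.
Context d (T : measurableType d) (R : realType).
Variables (mu : {measure set T -> \bar R}) (p : R).
Hypothesis p1 : 1 < p.
Implicit Types f g w : T -> R.

Local Notation Lp := (Lfun mu p%:E).
Local Notation N := (Lpnorm mu p).
Local Notation Ip f := (\int[mu]_x (`|f x| `^ p)).
Local Notation pair w f := (\int[mu]_x (spow (p - 1) (w x) * f x)).

Let p0 : 0 < p. Proof. by rewrite (lt_trans _ p1). Qed.
Let p1le : 1 <= p. Proof. exact: ltW. Qed.
Let p1E : (1 <= p%:E)%E. Proof. by rewrite lee_fin. Qed.

Lemma Lfun_measurable f : f \in Lp -> measurable_fun setT f.
Proof. by move=> /andP[/[!inE]]. Qed.

Lemma Lfun_comb a f g : f \in Lp -> g \in Lp -> (fun x => a * f x + g x) \in Lp.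
Proof. move=> fL gL.
have [_ H] := Lfun_submod_closed mu p1E.
exact: (H a f g fL gL). Qed.

Lemma Lfun_sub f g : f \in Lp -> g \in Lp -> (fun x => f x - g x) \in Lp.
Proof.
move=> fL gL; rewrite (_ : (fun _ => _) = (fun x => -1 * g x + f x)).
  exact: Lfun_comb.
by apply/funext => x; rewrite mulN1r addrC.
Qed.

Lemma Lnorm_EFin f : f \in Lp -> 'N[mu]_p%:E[EFin \o f]%E = (N f)%:E.
Proof.
move=> /andP[_ /[!inE]/= fL]; rewrite /Lpnorm fineK//.
by rewrite ge0_fin_numE ?Lnorm_ge0.
Qed.

Lemma integral_powR f : f \in Lp ->
  (\int[mu]_x (`|f x| `^ p)%:E = (Ip f)%:E)%E.
Proof.
move=> fL; rewrite /Rintegral fineK//.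
by apply: integrable_fin_num => //; exact: Lfun_integrable.
Qed.

Lemma Lpnorm_ge0 f : 0 <= N f.
Proof. by rewrite fine_ge0// Lnorm_ge0. Qed.

Lemma Lpnorm_powR f : f \in Lp -> N f `^ p = Ip f.
Proof.
move=> fL; apply: EFin_inj; rewrite -integral_powR// -poweR_EFin -Lnorm_EFin//.
by rewrite poweR_Lnorm ?gt_eqF.
Qed.

Lemma measurable_spow r f : 0 < r -> measurable_fun setT f ->
  measurable_fun setT (fun x => spow r (f x)).
Proof.
move=> r0 mf; rewrite (_ : (fun _ => _) = (fun x => f x * `|f x| `^ (r - 1))).
  apply: measurable_funM => //.
  apply: (measurableT_comp (measurable_powR _)).
  exact: measurableT_comp.
apply/funext => x; rewrite /spow {3}[f x]numEsg -mulrA; congr (_ * _).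
by rewrite mulr_powRB1.
Qed.

Lemma integrable_pair w f : w \in Lp -> f \in Lp ->
  mu.-integrable setT (EFin \o (fun x => spow (p - 1) (w x) * f x)).
Proof.
move=> wL fL.
apply: (@le_integrable _ _ _ _ _ measurableT _
  (fun x => (`|w x| `^ p)%:E + (`|f x| `^ p)%:E)%E).
- apply/measurable_EFinP; apply: measurable_funM; last exact: Lfun_measurable.
  by apply: measurable_spow; [rewrite subr_gt0|exact: Lfun_measurable].
- move=> x _ /=; rewrite lee_fin (ger0_norm (addr_ge0 _ _)) ?powR_ge0//.
  exact: ler_norm_spowM.
- by apply: integrableD => //; exact: Lfun_integrable.
Qed.

Lemma pair_comb w a f g : w \in Lp -> f \in Lp -> g \in Lp ->
  pair w (fun x => a * f x + g x) = a * pair w f + pair w g.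
Proof.
move=> wL fL gL; under eq_Rintegral do rewrite mulrDr mulrCA.
rewrite RintegralD ?RintegralZl//; [exact: integrable_pair..| |].
  exact: (integrableZl measurableT a (integrable_pair wL fL)).
exact: integrable_pair.
Qed.

Lemma pair_diag w : w \in Lp -> pair w w = N w `^ p.
Proof.
move=> wL; rewrite Lpnorm_powR//; apply: eq_Rintegral => x _.
by rewrite spow_mulr ?subrK// subr_ge0.
Qed.

(** Hölder with exponents [p / (p - 1)] and [p]: since [|J(w)| ^ (p / (p - 1)) = |w| ^ p], the
    conjugate norm of [J(w)] is [N w ^ (p - 1)]. *)
Lemma norm_pair w f : w \in Lp -> f \in Lp ->
  `|pair w f| <= N w `^ (p - 1) * N f.
Proof.
move=> wL fL.
have q0 : 0 < p / (p - 1) by rewrite divr_gt0// subr_gt0.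
have pq : (p / (p - 1))^-1 + p^-1 = 1.
  by field; rewrite gt_eqF// subr_eq0 gt_eqF.
have mw := Lfun_measurable wL; have mf := Lfun_measurable fL.
have p10 : 0 < p - 1 by rewrite subr_gt0.
have := hoelder mu (measurable_spow p10 mw) mf q0 p0 pq.
rewrite Lnorm_EFin//.
have -> : 'N[mu]_(p / (p - 1))%:E[EFin \o (fun x => spow (p - 1) (w x))]%E =
    (N w `^ (p - 1))%:E.
  rewrite unlock /=.
  have -> : (p / (p - 1))^-1 = p^-1 * (p - 1) by rewrite invf_div mulrC.
  rewrite poweRrM -poweR_EFin -Lnorm_EFin// unlock/=.
  congr ((_ `^ _) `^ _)%E; apply: eq_integral => x _.
  rewrite /spow normrM (ger0_norm (powR_ge0 _ _)) normr_sg.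
  have [->|wx] := eqVneq (w x) 0.
    by rewrite mul0r normr0 !powR0// gt_eqF.
  by rewrite mul1r -powRrM mulrC divfK// gt_eqF.
rewrite -EFinM => H; rewrite -lee_fin; apply: le_trans H.
rewrite Lnorm1 EFin_normr_Rintegral//; last exact: integrable_pair.
apply: le_abse_integral => //; apply: (measurable_int mu).
exact: integrable_pair.
Qed.

Lemma Lp_dual_pair w : w \in Lp -> Lp_dual mu p (fun f => pair w f).
Proof.
move=> wL; split; first by move=> a f g fL gL; exact: pair_comb.
by exists (N w `^ (p - 1)) => f fL; exact: norm_pair.
Qed.

End Lp.

(** * Gliding hump: one bounded functional that is large on every [x n] *)

Section GlidingHump.
Context d (T : measurableType d) (R : realType).
Variables (mu : {measure set T -> \bar R}) (p : R).
Hypothesis p1 : 1 < p.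
Variables (x : nat -> T -> R) (Psi : nat -> (T -> R) -> R).

Local Notation Lp := (Lfun mu p%:E).
Local Notation N := (Lpnorm mu p).

Hypothesis xL : forall n, x n \in Lp.
Hypothesis PsiD : forall n a f g, f \in Lp -> g \in Lp ->
  Psi n (fun t => a * f t + g t) = a * Psi n f + Psi n g.
Hypothesis PsiN : forall n f, f \in Lp -> `|Psi n f| <= N f.
Hypothesis Psix : forall n, Psi n (x n) = N (x n).

(* The sign makes the new term reinforce the value already reached at [x n], so
   that [hump n.+1 (x n)] is at least the new term, which is twice the total
   size of all later ones. *)
Fixpoint hump n : (T -> R) -> R :=
  if n is m.+1 then fun f => hump m f +
    (if 0 <= hump m (x m) then 1 else -1) * (3^-1 ^+ m * Psi m f)
  else fun=> 0.

Lemma hump_linear n a f g : f \in Lp -> g \in Lp ->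
  hump n (fun t => a * f t + g t) = a * hump n f + hump n g.
Proof.
move=> fL gL; elim: n => [|n IH] /=; first by rewrite mulr0 addr0.
by rewrite IH PsiD//; ring.
Qed.

Lemma hump_step n f : f \in Lp ->
  `|hump n.+1 f - hump n f| <= 3^-1 ^+ n * N f.
Proof.
move=> fL; rewrite /= addrC addKr normrM.
have -> : `|if 0 <= hump n (x n) then 1 else -1 : R| = 1.
  by case: ifP => _; rewrite ?normrN normr1.
rewrite mul1r normrM ger0_norm ?exprn_ge0 ?invr_ge0//.
by rewrite ler_wpM2l ?exprn_ge0 ?invr_ge0// PsiN.
Qed.

(** The constant is the geometric sum of ratio 1/3; keeping the subtracted power makes the induction
    on [m] close. *)
Lemma hump_tail n m f : f \in Lp ->
  `|hump (m + n) f - hump n f| <= 3 / 2 * N f * (3^-1 ^+ n - 3^-1 ^+ (m + n)).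
Proof.
move=> fL; elim: m => [|m IH]; first by rewrite add0n !subrr normr0 mulr0.
rewrite addSn; have := hump_step (m + n) fL.
rewrite exprS; move: (3^-1 ^+ (m + n)) IH => c.
have := ler_normD (hump (m + n).+1 f - hump (m + n) f)
  (hump (m + n) f - hump n f).
by rewrite addrA subrK; nra.
Qed.

Lemma hump_peak n : 3^-1 ^+ n * N (x n) <= `|hump n.+1 (x n)|.
Proof.
have c0 : 0 <= 3^-1 ^+ n * N (x n).
  by rewrite mulr_ge0 ?exprn_ge0 ?invr_ge0// Lpnorm_ge0.
rewrite /= Psix; move: (_ * N _) c0 => c c0; case: (leP 0 (hump n (x n))) => h.
  by rewrite ger0_norm; lra.
by rewrite ltr0_norm; lra.
Qed.

Definition hump_lim f := limn (fun n => hump n f).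

Lemma hump_cvg f : f \in Lp -> (fun n => hump n f) @ \oo --> hump_lim f.
Proof.
move=> fL; pose u n := hump n.+1 f - hump n f.
suff : cvgn (fun n => hump n f) by [].
have -> : (fun n => hump n f) = series u.
  apply/funext; elim => [|n IH]; first by rewrite /series/= big_geq.
  by rewrite seriesSr -IH /u subrKC.
apply: normed_cvg; apply: (@series_le_cvg _ _ (geometric (N f) 3^-1)) => //.
- by move=> n /=.
- by move=> n; rewrite /geometric/= mulr_ge0 ?exprn_ge0 ?invr_ge0// Lpnorm_ge0.
- by move=> n; rewrite /= mulrC hump_step.
- by apply: is_cvg_geometric_series; rewrite ger0_norm ?invr_ge0//; lra.
Qed.

Lemma hump_lim_tail n f : f \in Lp ->
  `|hump_lim f - hump n f| <= 3 / 2 * N f * 3^-1 ^+ n.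
Proof.
move=> fL.
have cv : (fun m => `|hump m f - hump n f|) @ \oo --> `|hump_lim f - hump n f|.
  by apply: cvg_norm; apply: cvgB; [exact: hump_cvg|exact: cvg_cst].
apply: (cvgr_to_le cv).
exists n => // m /= nm; rewrite -(subnK nm).
apply: (le_trans (hump_tail _ _ fL)); rewrite ler_wpM2l//.
  by rewrite mulr_ge0// Lpnorm_ge0.
by rewrite gerBl exprn_ge0// invr_ge0.
Qed.

Lemma Lp_dual_hump_lim : Lp_dual mu p hump_lim.
Proof.
split=> [a f g fL gL|].
  apply: cvg_lim => //; under eq_fun do rewrite hump_linear//.
  apply: cvgD; last exact: hump_cvg.
  by apply: cvgM; [exact: cvg_cst|exact: hump_cvg].
exists (3 / 2) => f fL; have := hump_lim_tail 0 fL.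
by rewrite /= subr0 expr0 mulr1.
Qed.

(** The terms after [hump n.+1] total at most [3 / 2 * 3^-1 ^+ n.+1 * N (x n)], half of the peak, so
    at least half of it survives in the limit. *)
Lemma hump_lim_peak n : 3^-1 ^+ n * N (x n) <= 2 * `|hump_lim (x n)|.
Proof.
have := hump_peak n; have := hump_lim_tail n.+1 (xL n); rewrite exprS.
rewrite distrC; have := ler_normD (hump n.+1 (x n) - hump_lim (x n)) (hump_lim (x n)).
by rewrite subrK; move: (3^-1 ^+ n) => c; lra.
Qed.

End GlidingHump.

(** * Boundedness from weak convergence, and the two cross terms *)

Section LpConvergence.
Context d (T : measurableType d) (R : realType).
Variables (mu : {measure set T -> \bar R}) (p : R).
Hypothesis p1 : 1 < p.
Variables (u : nat -> T -> R) (v : T -> R).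

Local Notation Lp := (Lfun mu p%:E).
Local Notation N := (Lpnorm mu p).
Hypothesis uL : forall n, u n \in Lp.
Hypothesis vL : v \in Lp.

Let p0 : 0 < p. Proof. by rewrite (lt_trans _ p1). Qed.

(** Otherwise the gliding hump yields [phi] in the dual with [|phi (w (k n))| >= n / 2] for all [n],
    whereas the convergent sequence [phi (u k)] is bounded. *)
Lemma Lp_weak_cvg_bounded : Lp_weak_cvg mu p u v ->
  exists M, forall k, N (fun t => u k t - v t) <= M.
Proof.
move=> uv; apply: contrapT => /forallNP unb.
pose w k t := u k t - v t.
have wL k : w k \in Lp by exact: Lfun_sub.
(* The factor [3 ^+ n] offsets the weight of the [n]-th hump, and the 1 keeps the norm positive. The
   indices chosen need not increase. *)
have big n : exists k, 1 + n%:R * 3 ^+ n <= N (w k).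
  apply: contrapT => /forallNP H; apply: (unb (1 + n%:R * 3 ^+ n)) => k.
  by have /negP := H k; rewrite -ltNge => /ltW.
have [k kP] := choice big.
(* The normalised duality functional: norm at most 1, attaining [N (w (k n))] at [w (k n)]. It
   supplies norming functionals explicitly, in place of Hahn-Banach. *)
pose Psi n f := (N (w (k n)) `^ (p - 1))^-1 *
  \int[mu]_t (spow (p - 1) (w (k n) t) * f t).
have N0 n : 0 < N (w (k n)).
  by apply: lt_le_trans (kP n); rewrite ltr_pwDl// mulr_ge0.
have PsiD n a f g : f \in Lp -> g \in Lp ->
    Psi n (fun t => a * f t + g t) = a * Psi n f + Psi n g.
  by move=> fL gL; rewrite /Psi pair_comb//; ring.
have PsiN n f : f \in Lp -> `|Psi n f| <= N f.
  move=> fL; rewrite /Psi normrM ger0_norm ?invr_ge0 ?powR_ge0//.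
  by rewrite ler_pdivrMl ?powR_gt0// norm_pair.
have Psix n : Psi n (w (k n)) = N (w (k n)).
  rewrite /Psi pair_diag// -(mulr_powRB1 (ltW (N0 n)) p0) mulrCA mulVf ?mulr1//.
  by rewrite gt_eqF// powR_gt0.
pose phi := hump_lim (fun n => w (k n)) Psi.
have phiD : Lp_dual mu p phi.
  exact (@Lp_dual_hump_lim _ _ _ mu p (fun n => w (k n)) Psi PsiD PsiN).
have phiB f g : f \in Lp -> g \in Lp -> phi (fun t => f t - g t) = phi f - phi g.
  move=> fL gL; rewrite (_ : (fun _ => _) = (fun t => -1 * g t + f t)).
    by rewrite phiD.1// mulN1r addrC.
  by apply/funext => t; rewrite mulN1r addrC.
have [B HB] : exists B, forall n, `|phi (u n)| <= B.
  have [B _ HB] := pinfty_ex_gt0 (cvg_seq_bounded (cvgP _ (uv phi phiD))).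
  by exists B => n; exact: HB.
have {}HB n : n%:R <= 2 * (B + `|phi v|).
  have := @hump_lim_peak _ _ _ mu p _ Psi (fun n => wL (k n)) PsiN Psix n.
  rewrite -/phi phiB//.
  have := HB (k n); have := ler_normB (phi (u (k n))) (phi v).
  have : n%:R <= 3^-1 ^+ n * N (w (k n)).
    rewrite exprVn ler_pdivlMl ?exprn_gt0// mulrC.
    by apply: le_trans (kP n); rewrite lerDr.
  by rewrite /=; lra.
have := Num.Theory.archi_boundP (normr_ge0 (2 * (B + `|phi v|))).
by rewrite ltNge (le_trans (HB _) (ler_norm _)).
Qed.

Lemma integrable_lin a b (f g : T -> R) :
  mu.-integrable setT (EFin \o f) -> mu.-integrable setT (EFin \o g) ->
  mu.-integrable setT (EFin \o (fun t => a * f t + b * g t)).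
Proof.
move=> fi gi; have := integrableD measurableT
  (integrableZl measurableT a fi) (integrableZl measurableT b gi).
by [].
Qed.

Lemma Rintegral_lin a b (f g : T -> R) :
  mu.-integrable setT (EFin \o f) -> mu.-integrable setT (EFin \o g) ->
  \int[mu]_t (a * f t + b * g t) = a * \int[mu]_t f t + b * \int[mu]_t g t.
Proof.
move=> fi gi; rewrite RintegralD ?RintegralZl//.
- exact: (integrableZl measurableT a fi).
- exact: (integrableZl measurableT b gi).
Qed.

Local Notation pair w f := (\int[mu]_x (spow (p - 1) (w x) * f x)).

Lemma Lpnorm_cross (f g : T -> R) : 3 <= p -> f \in Lp -> g \in Lp ->
  N f `^ p + N g `^ p + p * pair f g + p * pair g f
    <= N (fun t => f t + g t) `^ p.
Proof.
move=> p3 fL gL.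
have fgL : (fun t => f t + g t) \in Lp.
  rewrite (_ : (fun _ => _) = (fun t => 1 * f t + g t)); first exact: Lfun_comb.
  by apply/funext => t; rewrite mul1r.
have fi := Lfun_integrable (ltW p1) fL; have gi := Lfun_integrable (ltW p1) gL.
have fgi := integrable_pair p1 fL gL; have gfi := integrable_pair p1 gL fL.
rewrite !Lpnorm_powR//.
(* The factors [1] give the integrand the nested shape that [Rintegral_lin] matches. *)
have -> : \int[mu]_t (`|f t| `^ p) + \int[mu]_t (`|g t| `^ p) +
    p * pair f g + p * pair g f = \int[mu]_t
  (1 * (1 * `|f t| `^ p + 1 * `|g t| `^ p) +
   p * (1 * (spow (p - 1) (f t) * g t) + 1 * (spow (p - 1) (g t) * f t))).
  by rewrite !Rintegral_lin//; [ring|exact: integrable_lin..].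
apply: le_Rintegral => //.
- by apply: integrable_lin; exact: integrable_lin.
- exact: Lfun_integrable (ltW p1) fgL.
- by move=> t _; have := powR_cross (f t) (g t) p3; lra.
Qed.

Lemma Lpnorm_expand e (f g : T -> R) : 2 <= p -> 0 <= e <= 1 ->
    f \in Lp -> g \in Lp ->
  N (fun t => f t + e * g t) `^ p <= N f `^ p + p * e * pair f g
    + p * (p - 1) * 2 `^ p * e ^+ 2 * (N f `^ p + N g `^ p).
Proof.
move=> p2 e01 fL gL.
have fgL : (fun t => f t + e * g t) \in Lp.
  rewrite (_ : (fun _ => _) = (fun t => e * g t + f t)); first exact: Lfun_comb.
  by apply/funext => t; rewrite addrC.
have fi := Lfun_integrable (ltW p1) fL; have gi := Lfun_integrable (ltW p1) gL.
have fgi := integrable_pair p1 fL gL.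
rewrite !Lpnorm_powR//; set c := p * (p - 1) * _ * _.
have -> : \int[mu]_t (`|f t| `^ p) + p * e * pair f g +
    c * (\int[mu]_t (`|f t| `^ p) + \int[mu]_t (`|g t| `^ p)) = \int[mu]_t
  (1 * (1 * `|f t| `^ p + p * e * (spow (p - 1) (f t) * g t)) +
   c * (1 * `|f t| `^ p + 1 * `|g t| `^ p)).
  by rewrite !Rintegral_lin//; [ring|exact: integrable_lin..].
apply: le_Rintegral => //.
- exact: Lfun_integrable (ltW p1) fgL.
- by apply: integrable_lin; exact: integrable_lin.
- by move=> t _; have := powR_expand (f t) (g t) p2 e01; rewrite -/c; lra.
Qed.

(** [K] is fixed before [e], so letting [e] tend to 0 makes the lower limit of the pairing
    nonnegative. *)
Lemma Lp_delta_pair : 2 <= p -> Lp_weak_cvg mu p u v -> Lp_delta_cvg mu p u v ->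
  exists2 K, 0 <= K & forall e, 0 < e <= 1 ->
    \forall k \near \oo, - (K * e) <= pair (fun t => u k t - v t) v.
Proof.
move=> p2 uv duv; have [M HM] := Lp_weak_cvg_bounded uv.
have M0 : 0 <= M by apply: le_trans (HM 0%N); exact: Lpnorm_ge0.
pose C := p * (p - 1) * 2 `^ p.
have C0 : 0 <= C by rewrite !mulr_ge0 ?powR_ge0//; lra.
(* The total error is [e ^ 2] times the numerator: its first term comes from Delta-convergence, its
   second from [Lpnorm_expand]. Dividing by [p * e] leaves [K * e]. *)
exists ((p * M `^ (p - 1) + C * (M `^ p + N v `^ p)) / p).
  rewrite divr_ge0 ?(ltW p0)// addr_ge0// mulr_ge0 ?powR_ge0 ?(ltW p0)//.
  by rewrite addr_ge0 ?powR_ge0.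
move=> e /andP[e0 e1].
have zL : (fun t => - e * v t + v t) \in Lp by exact: Lfun_comb.
(* The tolerance [e ^ 2] matches the order of the expansion error, so it survives division by
   [e]. *)
have := limn_esup_le0_near (exprn_gt0 2 e0) (duv _ zL).
apply: filterS => k.
have wL : (fun t => u k t - v t) \in Lp by exact: Lfun_sub.
have -> : (fun t => u k t - (- e * v t + v t)) =
  (fun t => (u k t - v t) + e * v t) by apply/funext => t; ring.
have := HM k; move wE : (fun t => u k t - v t) wL => w wL wM.
have -> : (fun t => u k t - v t + e * v t) = (fun t => w t + e * v t).
  by rewrite -wE.
have -> : (fun t => spow (p - 1) (u k t - v t) * v t) =
  (fun t => spow (p - 1) (w t) * v t) by rewrite -wE.
have wvL : (fun t => w t + e * v t) \in Lp.
  rewrite (_ : (fun _ => _) = (fun t => e * v t + w t)); first exact: Lfun_comb.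
  by apply/funext => t; rewrite addrC.
rewrite !Lnorm_EFin// -EFinB lee_fin => ab.
have e01 : 0 <= e <= 1 by rewrite (ltW e0).
have E := Lpnorm_expand p2 e01 wL vL.
(* With [a = N w] and [b] the norm of [w + e * v], this reads [a ^ p - b ^ p <= p * a ^ (p - 1) * (a
   - b)]. *)
have := young_powR (ltW p1) (Lpnorm_ge0 mu p (fun t => w t + e * v t))
  (Lpnorm_ge0 mu p w).
move: E ab; rewrite -/C; move: (N (fun t => w t + e * v t)) => b.
have a0 := Lpnorm_ge0 mu p w.
rewrite -(mulr_powRB1 a0 p0) -(mulr_powRB1 M0 p0).
have aM : N w `^ (p - 1) <= M `^ (p - 1).
  by rewrite ge0_ler_powR ?nnegrE//; lra.
move: (N w) a0 wM aM => a a0 aM; move: (a `^ _) (powR_ge0 a (p - 1)) => a' a'0.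
move: (M `^ _) => M' aM' E ab Y.
(* The sign of [a - b] is unknown, so it is replaced by [e ^ 2] before [a'] is enlarged to [M']. *)
have h1 : a' * (a - b) <= M' * e ^+ 2.
  apply: (@le_trans _ _ (a' * e ^+ 2)); first by rewrite ler_wpM2l.
  by rewrite ler_wpM2r ?sqr_ge0.
have h2 : a * a' <= M * M' by exact: ler_pM.
have h3 : C * e ^+ 2 * (a * a') <= C * e ^+ 2 * (M * M').
  by rewrite ler_wpM2l// mulr_ge0// sqr_ge0.
have h4 : p * (a' * (a - b)) <= p * (M' * e ^+ 2) by rewrite ler_pM2l.
rewrite -(ler_pM2l (mulr_gt0 p0 e0)).
have -> : p * e * - ((p * M' + C * (M * M' + N v `^ p)) / p * e) =
    - (e ^+ 2 * (p * M' + C * (M * M' + N v `^ p))).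
  by field; rewrite gt_eqF.
lra.
Qed.

Lemma weak_pair : Lp_weak_cvg mu p u v ->
  (fun k => pair v (fun t => u k t - v t)) @ \oo --> (0 : R).
Proof.
move=> /(_ _ (Lp_dual_pair p1 vL)) uv.
rewrite (_ : (fun k => _) = (fun k => pair v (u k) - pair v v)).
  by rewrite -(subrr (pair v v)); apply: cvgB => //; exact: cvg_cst.
apply/funext => k; transitivity (pair v (fun t => -1 * v t + u k t)).
  by apply: eq_Rintegral => t _; rewrite mulN1r (addrC (- v t)).
by rewrite pair_comb// mulN1r addrC.
Qed.

End LpConvergence.

(** * Combining the two cross-term estimates *)

Theorem theorem4p2 (d : measure_display) (T : measurableType d) (R : realType)
  (mu : {measure set T -> \bar R}) (p : R) (hp : 3 <= p)
  (u : nat -> T -> R) (v : T -> R)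
  (hu : forall k, u k \in Lfun mu p%:E) (hv : v \in Lfun mu p%:E)
  (hweak : Lp_weak_cvg mu p u v) (hdelta : Lp_delta_cvg mu p u v) :
  (0 <= limn_einf (fun k =>
      \int[mu]_x ((`|u k x| `^ p)%:E)
    - \int[mu]_x ((`|v x| `^ p)%:E)
    - \int[mu]_x ((`|(u k x - v x)%R| `^ p)%:E)))%E.
Proof.
have p1 : 1 < p by lra.
have p2 : 2 <= p by lra.
have p0 : 0 < p by lra.
apply: limn_einf_ge0 => e e0.
have [K K0 HK] := Lp_delta_pair p1 hu hv p2 hweak hdelta.
(* Each cross term is allotted [e / 2]. The denominator has [K + 1] because [K] may be 0. *)
pose e' := Num.min 1 (e / (2 * p * (K + 1))).
have K1 : 0 < K + 1 by lra.
have e'01 : 0 < e' <= 1.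
  by rewrite lt_min ltr01 ge_min lexx/= divr_gt0// !mulr_gt0.
have Ke : p * (K * e') <= e / 2.
  have : K * e' <= (K + 1) * (e / (2 * p * (K + 1))).
    apply: ler_pM; rewrite ?(ltW (andP e'01).1)//; first lra.
    by rewrite ge_min lexx orbT.
  have -> : (K + 1) * (e / (2 * p * (K + 1))) = e / 2 / p.
    by field; rewrite !gt_eqF.
  by rewrite ler_pdivlMr// mulrC.
have [ep ep0] : exists2 ep, 0 < ep & p * ep = e / 2.
  by exists (e / 2 / p); [rewrite !divr_gt0|field; rewrite gt_eqF].
move=> epE; have /cvgrPdist_le /(_ _ ep0) H := weak_pair p1 hu hv hweak.
near=> k.
have wL : (fun t => u k t - v t) \in Lfun mu p%:E by exact: Lfun_sub.
rewrite !integral_powR// -!EFinB lee_fin -!Lpnorm_powR//.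
(* Applied to [v] and [u k - v], whose sum is [u k]. *)
have := Lpnorm_cross p1 hp hv wL.
rewrite (_ : (fun t => v t + (u k t - v t)) = u k); last first.
  by apply/funext => t; rewrite subrKC.
have : p * `|0 - \int[mu]_x (spow (p - 1) (v x) * (u k x - v x))| <= p * ep.
  by rewrite ler_pM2l//; near: k.
have : p * - (K * e') <= p * \int[mu]_x (spow (p - 1) (u k x - v x) * v x).
  by rewrite ler_pM2l//; near: k; exact: HK.
rewrite sub0r normrN; move: (\int[mu]_x (spow (p - 1) (v x) * _)) => S.
have : p * - S <= p * `|S| by rewrite ler_pM2l// -normrN ler_norm.
lra.
Unshelve. all: by end_near. Qed.
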